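(* For each positive integer $n$, let $P_n$ denote the probability that $\chi(g)=0$ when $\chi$ is chosen uniformly at random from the set of irreducible characters of the symmetric group $\mathfrak S_n$ and $g$ is chosen (independently) uniformly at random from $\mathfrak S_n$; that is, $$P_n=\frac{|\{(\chi,g)\in \mathrm{Irr}(\mathfrak S_n)\times\mathfrak S_n : \chi(g)=0\}|}{|\mathrm{Irr}(\mathfrak S_n)|\cdot n!}.$$ Then $P_n\to 1$ as $n\to\infty$.
   Context: $\mathfrak S_n$ is the symmetric group on $n$ letters, and $\mathrm{Irr}(G)$ denotes the (finite) set of irreducible complex characters of a finite group $G$. *)

(* Defs.v *)
From mathcomp Require Import all_boot all_order all_algebra.
From mathcomp Require Import all_fingroup all_field all_character.
From mathcomp Require Import all_classical all_reals all_analysis.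

Set Implicit Arguments.
Unset Strict Implicit.
Unset Printing Implicit Defensive.

Import Order.TTheory GRing.Theory Num.Theory.
Import numFieldNormedType.Exports.

Local Open Scope ring_scope.

(* Pairs of an irreducible character and a group element at which it vanishes.
   [i |-> 'chi_i] is a bijection from [Iirr G] onto Irr(G) (irr_inj, irrP), so
   characters are recorded by their index. Characters take values in [algC]:
   all values of complex characters of a finite group are algebraic. *)
Definition char_zeros (n : nat) :
    {set Iirr [set: 'S_n] * 'S_n} :=
  [set p | 'chi_(p.1) p.2 == 0].

Definition char_zero_prob (R : realType) (n : nat) : R :=
  #|char_zeros n|%:R / (#|Iirr [set: 'S_n]| * n`!)%:R.

(* Main.v *)
Require Import Defs.
From mathcomp Require Import all_boot all_order all_algebra.
From mathcomp Require Import all_fingroup all_solvable all_field all_character.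
From mathcomp Require Import zify.

Set Implicit Arguments.
Unset Strict Implicit.
Unset Printing Implicit Defensive.

Import Order.TTheory GRing.Theory Num.Theory.

(** For a fixed [g], the values [chi g] and [chi s] over the generators [s] of
    [<[g]>] are Galois conjugate algebraic integers, so if [chi g <> 0] then
    [|chi s|^2] averages to at least 1 over these [s]; the second orthogonality
    relation then shows that at most [#|'C[g]|] irreducible characters do not
    vanish at [g].  In the symmetric group, [#|'C[g]|] is at most [n ^ c] when
    [g] has at most [c] cycles, and since [2 ^ (number of cycles)] has mean at
    most [n + 1], all but a proportion [(n + 1) / 2 ^ c] of the [g] are of this
    kind.  With [c] about [2 log2 n] the bound [n ^ c] is quasi-polynomial,
    whereas the number of irreducible characters, that is of conjugacy classes,
    is at least [2 ^ m] for [m] of order [sqrt n]. *)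

(** * Zeros of irreducible characters and centralizers *)

Local Open Scope ring_scope.

(** If [s = g ^+ k] with [k] coprime to [#[g]], the automorphism [u] raising [#[g]]-th roots of
    unity to the power [k] sends [chi g] to [chi s], as [chi] restricts to a sum of linear
    characters of [<[g]>]. *)
Lemma char_eq0_generator (gT : finGroupType) (G : {group gT}) (chi : 'CF(G))
    (g s : gT) : chi \is a character -> g \in G -> generator <[g]>%g s ->
  chi g = 0 -> chi s = 0.
Proof.
move=> Nchi Gg /[dup] /cycle_generator/cycleP[k ->].
rewrite generator_coprime coprime_sym => cogk chig0.
have [u Du] := Qn_aut_exists cogk.
have sgG: <[g]>%g \subset G by rewrite cycle_subG.
suffices <-: u (chi g) = chi (g ^+ k)%g by rewrite chig0 rmorph0.
rewrite -!(cfResE chi sgG) ?mem_cycle ?cycle_id //.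
have [r ->] := char_sum_irr (cfRes_char <[g]> Nchi).
rewrite !sum_cfunE rmorph_sum; apply: eq_bigr => i _.
have Li: 'chi_i \is a linear_char by rewrite irr_cyclic_lin ?cycle_cyclic.
rewrite lin_charX ?cycle_id // Du //.
by rewrite -lin_charX ?cycle_id // expg_order lin_char1.
Qed.

Lemma card_irr_neq0_le_cent (gT : finGroupType) (G : {group gT}) (g : gT) :
  g \in G -> (#|[set i : Iirr G | 'chi_i g != 0%R]| <= #|'C_G[g]%g|)%N.
Proof.
move=> Gg; pose S := [pred s | generator <[g]>%g s].
have S0 : 0 < #|S|%:R :> algC.
  by rewrite ltr0n; apply/card_gt0P; exists g; rewrite inE generator_cycle.
have sgG: <[g]>%g \subset G by rewrite cycle_subG.
have cS s : s \in S -> 'C[s]%g = 'C[g]%g.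
  by move/eqP=> e; rewrite -[RHS]cent_cycle e cent_cycle.
have norm2S :
    \sum_i \sum_(s in S) `|'chi[G]_i s| ^+ 2 = #|S|%:R * #|'C_G[g]%g|%:R.
  rewrite exchange_big /= -natrM -sum_nat_const natr_sum.
  apply: eq_bigr => s Ss; have Gs := subsetP sgG s (cycle_generator Ss).
  under eq_bigr do rewrite normCK.
  by rewrite second_orthogonality_relation // class_refl mulr1n cS.
rewrite -(ler_nat algC) -(ler_pM2l S0) -norm2S.
rewrite -sum1_card natr_sum mulr_sumr big_mkcond ler_sum //= => i _.
have norm2_ge0 A : 0 <= \sum_(s in A) `|'chi_i s| ^+ 2.
  by rewrite sumr_ge0 // => s _; rewrite exprn_ge0.
rewrite inE mulr1; case: ifPn => // nz.
have resS s : s \in S -> 'chi_i s = 'Res[<[g]>%G] 'chi_i s.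
  by move=> Ss; rewrite cfResE ?cycle_generator.
rewrite (eq_bigr (fun s => `|'Res[<[g]>%G] 'chi_i s| ^+ 2)) => [|s /resS-> //].
apply: sum_norm2_char_generators => [|s Ss].
  by rewrite cfRes_char ?irr_char.
(* Being generators of the same cyclic group is symmetric, so a zero at [s] would force one at
   [g]. *)
rewrite -resS //; apply: contraNneq nz => /(char_eq0_generator (irr_char i)) -> //.
  exact: subsetP sgG _ (cycle_generator Ss).
by move: (Ss : generator _ _); rewrite /generator eq_sym => /eqP<-.
Qed.

(* Centralizers and cycle counts of permutations *)
Local Close Scope ring_scope.
Local Open Scope group_scope.

(* An element of the centralizer is determined by its values on one
   representative of each cycle. *)
Lemma card_cent1_perm (T : finType) (g : {perm T}) :
  #|'C[g]| <= #|T| ^ #|porbits g|.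
Proof.
have repP (O : {O | O \in porbits g}) : {x | porbit g x = val O}.
  by apply: sig_eqW; have /imsetP[x _ ->] := valP O; exists x.
pose F (h : {perm T}) := [ffun O => h (sval (repP O))].
have injF : {in 'C[g] &, injective F}.
  move=> h1 h2 /cent1P c1 /cent1P c2 /ffunP eF; apply/permP => x.
  have Ox : porbit g x \in porbits g by rewrite imset_f.
  pose O : {O | O \in porbits g} := Sub (porbit g x) Ox.
  have := eF O; rewrite !ffunE /=; case: (repP _) => y /= Oy eqy.
  have /porbitP[i ->] : x \in porbit g y by rewrite Oy porbit_id.
  have cE h : commute g h -> h ((g ^+ i) y) = (g ^+ i) (h y).
    by move=> /commute_sym/(commuteX i) /permP/(_ y); rewrite !permM.
  by rewrite !cE ?eqy.
by rewrite -(card_in_imset injF) (leq_trans (max_card _)) // card_ffun card_sig.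
Qed.

(** Makes cardinality a complete invariant of the orbits on subsets. The permutation matches a
    listing of [A] followed by its complement with the same kind of listing for [B]. *)
Lemma perm_imset_exists (T : finType) (A B : {set T}) :
  #|A| = #|B| -> exists g : {perm T}, B = g @: A.
Proof.
move=> eqAB; pose s (C : {set T}) := enum C ++ enum (~: C).
have ss C x : x \in s C by rewrite mem_cat !mem_enum inE orbN.
have us C : uniq (s C).
  rewrite cat_uniq !enum_uniq andbT /=; apply/hasPn => x.
  by rewrite !mem_enum inE.
have zs C : size (s C) = #|T| by rewrite size_cat -!cardE cardsC.
pose f x := nth x (s B) (index x (s A)).
have fI : injective f.
  move=> x y; rewrite /f (set_nth_default y) ?zs -?(zs A) ?index_mem //.
  move/eqP; rewrite nth_uniq ?zs -?(zs A) ?index_mem // => /eqP e.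
  by rewrite -(nth_index x (ss A x)) e nth_index.
exists (perm fI); apply/esym/eqP; rewrite eqEcard card_imset ?eqAB ?leqnn ?andbT.
  apply/subsetP=> _ /imsetP[x Ax ->]; rewrite permE /f index_cat mem_enum Ax.
  have lt : index x (enum A) < size (enum B).
    by rewrite -cardE -eqAB cardE index_mem mem_enum.
  by rewrite nth_cat lt -mem_enum mem_nth.
exact: perm_inj.
Qed.

(* Burnside's lemma for the action on subsets: unions of cycles of [g] are
   fixed by [g], and an orbit is determined by the cardinality of its members. *)
Lemma sum_exp2_porbits (T : finType) :
  \sum_(g : {perm T}) 2 ^ #|porbits g| <= #|T|.+1 * #|T|`!.
Proof.
have acts : [acts [set: {perm T}], on [set: {set T}] | 'P^*].
  by apply/actsP=> g _ A; rewrite !inE.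
have card_perms : #|[set: {perm T}]| = #|T|`!.
  rewrite -cardsT -card_perm; apply: eq_card => g; rewrite !inE.
  by apply/esym/subsetP => x; rewrite !inE.
have := Frobenius_Cauchy acts; rewrite card_perms.
set N := #|orbit _ _ @: _| => FC.
have N_le : N <= #|T|.+1.
  rewrite -[#|T|.+1]card_ord /N.
  (* The default [set0] never arises, since orbits are nonempty. *)
  pose F (O : {set {set T}}) : 'I_#|T|.+1 :=
    inord #|odflt set0 [pick A in O]|.
  rewrite -(@card_in_imset _ _ F) ?max_card //.
  move=> _ _ /imsetP[A _ ->] /imsetP[B _ ->].
  have cardO C :
      #|odflt set0 [pick A in orbit 'P^* [set: {perm T}] C]| = #|C|.
    case: pickP => [_ /orbitP[g _ <-] /=|/(_ C)]; last by rewrite orbit_refl.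
    by rewrite /setact card_imset //; apply: perm_inj.
  move/(congr1 (@nat_of_ord _)); rewrite /F !cardO !inordK ?ltnS ?max_card //.
  move=> /perm_imset_exists[g ->]; apply/esym/orbit_eqP.
  by apply/orbitP; exists g; rewrite ?inE.
apply: (@leq_trans (N * #|T|`!)); last by rewrite leq_mul2r N_le orbT.
rewrite -FC [leqRHS](eq_bigl xpredT) => [|g]; last by rewrite inE.
apply: leq_sum => g _.
(* Cycles being disjoint, [cover] embeds the sets of cycles of [g] into the subsets fixed by [g]. *)
rewrite -card_powerset -(@card_in_imset _ _ cover).
  apply/subset_leq_card/subsetP=> _ /imsetP[P + ->]; rewrite inE => /subsetP sP.
  rewrite !inE sub1set inE; apply/eqP.
  rewrite /= /setact; apply/setP=> x.
  have stab (y : T) : (g y \in cover P) = (y \in cover P).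
    apply/bigcupP/bigcupP => -[O PO yO]; exists O => //;
      have /imsetP[z _ eO] := sP _ PO; move: yO; rewrite eO -!eq_porbit_mem;
      by rewrite -[g]expg1 porbit_perm.
  apply/imsetP/idP => [[y Py ->]|Px]; first by rewrite -stab in Py.
  exists (g^-1 x); last exact: esym (permKV g x).
  by rewrite -stab permKV.
move=> P Q; rewrite !inE.
have coverE (R : {set {set T}}) x : R \subset porbits g ->
    (porbit g x \in R) = (x \in cover R).
  move=> /subsetP sR; apply/idP/bigcupP => [Rx|[O RO]].
    by exists (porbit g x); rewrite ?porbit_id.
  have /imsetP[z _ eO] := sR _ RO; rewrite eO -eq_porbit_mem => /eqP->.
  by rewrite -eO.
move=> sP sQ ePQ; apply/setP=> O.
have [/imsetP[x _ ->]|nO] := boolP (O \in porbits g).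
  by rewrite !coverE // ePQ.
by rewrite (contraNF (subsetP sP O)) ?(contraNF (subsetP sQ O)).
Qed.

(** * Cycle lengths and the number of conjugacy classes *)

Lemma porbit_fix (T : finType) (g : {perm T}) x :
  g x = x -> porbit g x = [set x].
Proof.
move=> gx; apply/setP=> y; rewrite inE.
apply/porbitP/eqP=> [[i ->]|->]; last by exists 0; rewrite perm1.
by rewrite permX iter_fix.
Qed.

Lemma eq_in_porbit (T : finType) (D : {pred T}) (g h : {perm T}) :
  {in D, g =1 h} -> {in D, forall x, h x \in D} -> {in D, porbit g =1 porbit h}.
Proof.
move=> gh hD x Dx.
have ghX i : (g ^+ i) x = (h ^+ i) x /\ (h ^+ i) x \in D.
  elim: i => [|i [IHe IHD]]; first by rewrite !expg0 perm1.
  by rewrite !expgSr !permM IHe gh // hD.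
by apply/setP=> y; apply/porbitP/porbitP=> -[i ->]; exists i; case: (ghX i).
Qed.

Lemma porbitJ (T : finType) (g h : {perm T}) x :
  porbit (g ^ h) (h x) = h @: porbit g x.
Proof.
apply/setP=> y; apply/porbitP/imsetP=> [[i ->]|[_ /porbitP[i ->] ->]].
  by exists ((g ^+ i) x); rewrite ?mem_porbit // -conjXg permJ.
by exists i; rewrite -conjXg permJ.
Qed.

Lemma cycle_perm_exists (T : finType) (p : seq T) : uniq p ->
  exists2 c : {perm T}, perm_on [set x in p] c &
    {in p, forall x, porbit c x = [set x in p]}.
Proof.
move=> up; exists (perm (can_inj (prev_next up))).
  apply/subsetP=> x; rewrite !inE permE; apply: contraNT => /negbTE px.
  by rewrite next_nth px.
move=> x px; apply/setP=> y; rewrite inE -(fconnect_cycle (cycle_next up) px).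
apply/porbitP/idP => [[i ->]|/iter_findex <-].
  by rewrite permX (eq_iter (permE _)) fconnect_iter.
by exists (findex (next p) x y); rewrite permX (eq_iter (permE _)).
Qed.

(** Induction on [S]: a cycle on a block [B] of [s] points is multiplied by a permutation supported
    on [A :\: B]. Length 1 is left out because points off the blocks are fixed, length 0 because
    cycles are nonempty. *)
Lemma perm_cycle_lengths_exists (T : finType) (S : seq nat) (A : {set T}) :
  sumn S <= #|A| ->
  exists2 g : {perm T}, perm_on A g &
    forall k, 1 < k -> (k \in S) = [exists x, #|porbit g x| == k].
Proof.
elim: S A => [|s S IHS] A /=.
  exists 1; first exact: perm_on1.
  move=> k k1; rewrite in_nil; apply/esym/negbTE/existsP=> -[x].
  by rewrite porbit_fix ?perm1 // cards1 => /eqP ek; rewrite -ek in k1.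
move=> le_sS_A.
have /card_geqP[p [up sp /subsetP pA]] := leq_trans (leq_addr _ _) le_sS_A.
pose B := [set x in p].
have BA : B \subset A by apply/subsetP=> x; rewrite inE => /(subsetP pA).
have cB : #|B| = s by rewrite cardsE (card_uniqP up).
have [|g gA gS] := IHS (A :\: B).
  by rewrite cardsD (setIidPr BA) cB leq_subRL // -cB subset_leq_card.
have [c cp cB'] := cycle_perm_exists up.
have fixg x : x \in B -> g x = x by move=> Bx; rewrite (out_perm gA) // inE Bx.
have gB x : (g x \in B) = (x \in B).
  apply/idP/idP=> Bx; last by rewrite fixg.
  by rewrite -(perm_inj (fixg _ Bx)).
have orbB x : x \in B -> porbit (c * g) x = B.
  move=> Bx; have px : x \in p by rewrite inE in Bx.
  rewrite /B -(cB' x px); apply: (@eq_in_porbit _ (mem B)) => // y By; last first.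
    by rewrite perm_closed.
  by rewrite permM fixg // perm_closed.
have orbNB x : x \notin B -> porbit (c * g) x = porbit g x.
  move=> nBx; apply: (@eq_in_porbit _ [predC B]) => // y /= nBy.
    by rewrite permM (out_perm cp nBy).
  by rewrite inE /= gB.
exists (c * g).
  apply: perm_onM; last exact: subset_trans gA (subsetDl _ _).
  exact: subset_trans cp BA.
move=> k k1; rewrite inE gS //; apply/orP/existsP.
  case=> [/eqP ek|/existsP[x xk]].
    have /card_gt0P[x Bx] : 0 < #|B| by rewrite cB -ek ltnW.
    by exists x; rewrite orbB ?cB ?ek.
  exists x; rewrite orbNB //; apply: contraL xk => Bx.
  by rewrite porbit_fix ?fixg // cards1 neq_ltn k1.
case=> x; have [Bx|nBx] := boolP (x \in B).
  by rewrite orbB // cB eq_sym; left.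
by rewrite orbNB // => xk; right; apply/existsP; exists x.
Qed.

(* Each subset of {2, ..., m+1} is the set of nontrivial cycle lengths of some
   permutation. *)
Lemma exp2_le_card_classes_perm (T : finType) (m : nat) :
  m * m.+1 <= #|T| -> 2 ^ m <= #|classes [set: {perm T}]|.
Proof.
(* The shift by 2 keeps all lengths above 1, where fixed points cannot interfere. *)
move=> le_m_T; pose S (D : {set 'I_m}) := [seq i.+2 | i : 'I_m <- enum D].
have memS (D : {set 'I_m}) (i : 'I_m) : (i.+2 \in S D) = (i \in D).
  rewrite -(mem_enum D); apply: (mem_map (f := fun i : 'I_m => i.+2)).
  by move=> ? ? [/val_inj].
have sumS D : sumn (S D) <= #|[set: T]|.
  rewrite cardsT (leq_trans _ le_m_T) // sumnE big_map big_enum /=.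
  rewrite -[m in (m * _)%N]card_ord -sum_nat_const big_mkcond leq_sum // => i _.
  by case: ifP => // _; rewrite ltnS ltn_ord.
have /fin_all_exists[g gS] : forall D, exists g : {perm T},
    forall k, 1 < k -> (k \in S D) = [exists x, #|porbit g x| == k].
  by move=> D; have [g _ gS] := perm_cycle_lengths_exists (sumS D); exists g.
(* Conjugation preserves cycle lengths, and these recover [D]. *)
have injg : injective (fun D => g D ^: [set: {perm T}]).
  move=> D1 D2 /class_eqP/imsetP[h _ eg]; apply/setP=> i.
  rewrite -!memS !gS // eg; apply/existsP/existsP => -[x xk].
    by exists (h^-1 x); rewrite -(card_imset _ (@perm_inj _ h)) -porbitJ permKV.
  by exists (h x); rewrite porbitJ card_imset //; apply: perm_inj.
rewrite -[m in (2 ^ m)%N]card_ord -cardsT -card_powerset -(card_imset _ injg).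
by apply/subset_leq_card/subsetP=> _ /imsetP[D _ ->]; rewrite mem_classes ?inE.
Qed.

(* Numerical estimates and the count of nonzero values *)
Local Close Scope group_scope.

(** For [L = up_log 2 n] the right side is below [n], so the left side, of the form [m * m.+1],
    meets the hypothesis of the class count. *)
Lemma quartic_le_exp2 (L : nat) : 48 <= L ->
  (L * L.*2 + L) * (L * L.*2 + L).+1 <= 2 ^ L.-1.
Proof.
(* Here [L <= 2 ^ (3 + q)], so [16 * L ^ 4 <= 2 ^ (16 + 4 * q)], and [16 + 4 * q <= L.-1] since
   [q >= 6]. *)
set m := L * L.*2 + L => L48; pose q := L %/ 8.
have q2 : q.+1 <= 2 ^ q by apply: ltn_expl.
have L_le : L <= 2 ^ (3 + q) by rewrite expnD /q in q2 *; lia.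
have mm : m * m.+1 <= 2 ^ 4 * L ^ 4.
  rewrite [L ^ 4](expnM L 2 2) /m.
  apply: (@leq_trans ((3 * L ^ 2) * (4 * L ^ 2))); last by lia.
  by apply: leq_mul; nia.
apply: (leq_trans mm); apply: (@leq_trans (2 ^ 4 * (2 ^ (3 + q)) ^ 4)).
  by rewrite leq_mul2l leq_exp2r ?L_le ?orbT.
by rewrite -expnM -expnD leq_exp2l // /q; lia.
Qed.

(** The centralizer bound handles the [g] with at most [c] cycles. For the others the trivial bound
    is weighted by [2 ^ #|porbits g| >= 2 ^ c], as in Markov's inequality. *)
Lemma card_char_nonzeros_le (n c : nat) : 0 < n ->
  #|~: char_zeros n| * 2 ^ c <=
    n`! * (n ^ c * 2 ^ c + n.+1 * #|Iirr [set: 'S_n]|).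
Proof.
move=> n0; set k := #|Iirr _|.
have cardS : #|'S_n| = n`! by rewrite -card_Sn; apply: eq_card => g; rewrite inE.
pose N (g : 'S_n) := #|[set i : Iirr [set: 'S_n] | ('chi_i g != 0)%R]|.
have -> : #|~: char_zeros n| = \sum_g N g.
  rewrite -sum1_card.
  rewrite (eq_bigl (fun p => ('chi_(p.1) p.2 != 0)%R)) => [|p]; last first.
    by rewrite !inE.
  rewrite -(pair_big_dep xpredT (fun i g => 'chi_i g != 0)%R (fun _ _ => 1)) /=.
  rewrite (exchange_big_dep xpredT) //=; apply: eq_bigr => g _.
  by rewrite sum1_card; apply: eq_card => i; rewrite !inE.
have N_le g : N g * 2 ^ c <= n ^ c * 2 ^ c + k * 2 ^ #|porbits g|.
  have [le_c|gt_c] := leqP #|porbits g| c.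
    apply: leq_trans (leq_addr _ _); rewrite leq_mul2r; apply/orP; right.
    apply: leq_trans (card_irr_neq0_le_cent (in_setT g)) _.
    apply: leq_trans (subset_leq_card (subsetIr _ _)) _.
    by apply: leq_trans (card_cent1_perm g) _; rewrite card_ord leq_pexp2l.
  apply: leq_trans (leq_addl _ _).
  by rewrite leq_mul ?max_card // leq_pexp2l // ltnW.
rewrite big_distrl /=; apply: (leq_trans (leq_sum _ (fun g _ => N_le g))).
rewrite big_split /= sum_nat_const cardS -big_distrr /= mulnDr leq_add2l.
have := sum_exp2_porbits 'I_n; rewrite card_ord => le_sum.
by rewrite [leqRHS]mulnC mulnAC [leqRHS]mulnC leq_mul2l le_sum orbT.
Qed.

Lemma card_char_nonzeros_le_inv (n : nat) : 2 ^ 48 < n ->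
  n * #|~: char_zeros n| <= 3 * (#|Iirr [set: 'S_n]| * n`!).
Proof.
move: (48) quartic_le_exp2 => b quartic n_big; set k := #|Iirr _|.
have n0 : 0 < n by apply: leq_ltn_trans n_big.
pose L := up_log 2 n; have n_le : n <= 2 ^ L by apply: up_logP.
have bL : b <= L by rewrite -(leq_exp2l _ _ (ltnSn 1)) (leq_trans _ n_le) // ltnW.
(* Chosen so that [2 ^ m = 2 ^ L * (2 ^ L) ^ L.*2], which is at least [n * n ^ L.*2]. *)
pose m := L * L.*2 + L.
have k_ge : 2 ^ m <= k.
  rewrite /k card_ord NirrE; apply: exp2_le_card_classes_perm; rewrite card_ord.
  apply: leq_trans (quartic _ bL) (ltnW _).
  apply: up_log_gtn => //; apply: leq_ltn_trans n_big.
  by rewrite expn_gt0.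
have nc : n * n ^ L.*2 <= k.
  apply: leq_trans k_ge; rewrite /m addnC expnD expnM leq_mul //.
  by case: (L.*2) => [|l]; rewrite ?expn0 ?leq_exp2r.
have nn : n * n.+1 <= 2 * 2 ^ L.*2.
  rewrite -addnn expnD; apply: (@leq_trans (2 * (n * n))); first by nia.
  by rewrite leq_mul2l leq_mul.
(* The choice [c = L.*2] gives [2 ^ c >= n ^ 2]; the two terms then contribute 1 and 2 to the factor
   3. *)
have := card_char_nonzeros_le L.*2 n0; rewrite -/k.
move: #|~: _| (n`!) (n ^ _) (2 ^ L.*2) (expn_gt0 2 L.*2) nc nn.
move=> z f e t t0 nc nn le_z.
rewrite -(@leq_pmul2r t) // -mulnA (@leq_trans (n * (f * (e * t + n.+1 * k)))) //.
  by rewrite leq_mul2l le_z orbT.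
have -> : n * (f * (e * t + n.+1 * k)) = f * (n * e * t + n * n.+1 * k) by lia.
have -> : 3 * (k * f) * t = f * (k * t + 2 * t * k) by lia.
by rewrite leq_mul2l leq_add ?orbT // leq_mul2r ?nc ?nn orbT.
Qed.

(* Passage to the limit *)
From mathcomp Require Import all_classical all_reals all_analysis.

Import numFieldNormedType.Exports.

Local Open Scope classical_set_scope.
Local Open Scope ring_scope.

Theorem mainTheorem1 (R : realType) :
  char_zero_prob R n @[n --> \oo] --> (1 : R).
Proof.
apply/cvgrPdist_le => e e0; near=> n.
have n0 : 0 < n%:R :> R.
  by rewrite ltr0n; near: n; exists 1%N.
rewrite /char_zero_prob; set d := (#|Iirr _| * _)%N.
have cardS : #|'S_n| = n`! by rewrite -card_Sn; apply: eq_card => g; rewrite inE.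
have d0 : 0 < d%:R :> R by rewrite ltr0n muln_gt0 card_ord fact_gt0.
have numE : d%:R - #|char_zeros n|%:R = #|~: char_zeros n|%:R :> R.
  by rewrite /d -cardS -card_prod -(cardsC (char_zeros n)) natrD addrC addKr.
rewrite -[X in X - _](@divff _ d%:R) ?gt_eqF // -mulrBl numE.
rewrite ger0_norm ?divr_ge0 //.
(* The proportion of nonzero values is at most [3 / n], hence at most [e] once [n >= 3 / e]. *)
rewrite ler_pdivrMr // -(ler_pM2l n0); apply: (@le_trans _ _ (3 * d%:R)).
  rewrite -!natrM ler_nat; apply: card_char_nonzeros_le_inv.
  by near: n; exists (2 ^ 48).+1.
rewrite mulrA ler_pM2r // -ler_pdivrMr //.
near: n; exact: nbhs_infty_ger.
Unshelve. all: by end_near.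
Qed.
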